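(* Let $E\to M$ be a complex vector bundle over a smooth manifold. Then $BCS$-equivalence is an equivalence relation on the set of connections on $E$.
   Context: Loop space. $LM=C^\infty(S^1,M)$ with $S^1=\mathbb R/\mathbb Z$ is the free loop space; infinite sums of forms of distinct even (odd) degrees are allowed in $\Omega^{even}(LM)$ ($\Omega^{odd}(LM)$). $\iota$ is contraction with the vector field $\gamma\mapsto\gamma'$. $\Omega_{S^1}(LM)=\Omega^{even}_{S^1}(LM)\oplus\Omega^{odd}_{S^1}(LM)$ denotes the forms in the kernel of $(d+\iota)^2=d\iota+\iota d$, with differential $d+\iota$. A form in $\Omega^{odd}_{S^1}(LM)$ is $(d+\iota)$-exact if it equals $(d+\iota)H$ for some $H\in\Omega^{even}_{S^1}(LM)$. $BCS$-equivalence. Two connections $\nabla_0,\nabla_1$ on $E$ are $BCS$-equivalent if $BCS(\nabla_s)$ is $(d+\iota)$-exact for some path of connections $\nabla_s$ ($s\in[0,1]$, (piecewise) smooth in $s$) on $E$ from $\nabla_0$ to $\nabla_1$. Bismut-Chern-Simons form. Let $\{U_i\}$ be an open cover of $M$ with trivializations of $E|_{U_i}$, transition functions $g_{ij}$, in which $\nabla_s$ is given by matrices of 1-forms $A_{s,i}$ with curvature $R_{s,i}=dA_{s,i}+A_{s,i}\wedge A_{s,i}$, $A_{s,j}=g_{ij}^{-1}A_{s,i}g_{ij}+g_{ij}^{-1}dg_{ij}$, and $A'_{s,i}=\partial A_{s,i}/\partial s$. For $p\in\mathbb N$ and $\mathcal U=(U_{i_1},\dots,U_{i_p})$ let $\mathcal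 N(p,\mathcal U)=\{\gamma\in LM:\gamma([\frac{r-1}p,\frac rp])\subset U_{i_r},\ r=1,\dots,p\}$; these sets cover $LM$. For a matrix-valued form $\omega$ on $U_i$, $\omega(t)$ is its pullback under $\gamma\mapsto\gamma(t)$, and $\iota A(t)$ is the function $\gamma\mapsto A(\gamma'(t))$. Then $BCS(\nabla_s)=\sum_{k\ge0}BCS_{2k+1}(\nabla_s)\in\Omega^{odd}_{S^1}(LM)$, where $BCS_{2k+1}$ is given on $\mathcal N(p,\mathcal U)$ by $$Tr\Big(\int_0^1\sum_{n_1,\dots,n_p\ge0}\ \sum_{J\subset S,\,|J|=k,\ (q,m)\in S\setminus J} g_{i_p,i_1}(\gamma(0))\wedge I_1\wedge g_{i_1,i_2}(\gamma(\tfrac1p))\wedge\cdots\wedge g_{i_{p-1},i_p}(\gamma(\tfrac{p-1}p))\wedge I_p\ ds\Big),$$ $$I_r=\int_{\frac{r-1}p\le t_1\le\dots\le t_{n_r}\le\frac rp}X_r^1(t_1)\cdots X_r^{n_r}(t_{n_r})\,dt_1\cdots dt_{n_r},$$ $S=\{(r,j):1\le r\le p,\ 1\le j\le n_r\}$, $X_r^j=R_{s,i_r}$ if $(r,j)\in J$, $X_r^j=A'_{s,i_r}$ if $(r,j)=(q,m)$, and $X_r^j=\iota A_{s,i_r}$ otherwise. It is independent of all choices. *)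

(* Defs.v *)
From HB Require Import structures.
From mathcomp Require Import all_boot all_order all_algebra all_fingroup.
From mathcomp Require Import all_classical all_reals all_analysis.
From mathcomp Require Import complex.
From Corelib Require Export RelationClasses.

Set Implicit Arguments.
Unset Strict Implicit.
Unset Printing Implicit Defensive.

Import Order.TTheory GRing.Theory Num.Theory.
Import numFieldNormedType.Exports.

Local Open Scope classical_set_scope.
Local Open Scope ring_scope.

(* On an open subset [U] of a finite-dimensional space this is the usual C^k:
   all directional derivatives up to order [k] exist and are continuous. *)
Fixpoint Ck_on (R : realType) (V W : normedModType R) (k : nat) (U : set V)
    (f : V -> W) : Prop :=
  (forall x, U x -> {for x, continuous f}) /\
  if k is k'.+1 then
    forall v, (forall x, U x -> derivable f x v) /\ Ck_on k' U ('D_v f)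
  else True.

Definition smooth_at (R : realType) (V W : normedModType R)
    (f : V -> W) (x : V) : Prop :=
  exists U : set V, [/\ open U, U x & forall k, Ck_on k U f].

Definition csmooth_at (R : realType) (V : normedModType R)
    (f : V -> R[i]) (x : V) : Prop :=
  smooth_at (fun y => complex.Re (f y) : R^o) x /\
  smooth_at (fun y => complex.Im (f y) : R^o) x.

Definition cderive (R : realType) (V : normedModType R)
    (f : V -> R[i]) (x v : V) : R[i] :=
  Complex ('D_v (fun y => complex.Re (f y) : R^o) x)
          ('D_v (fun y => complex.Im (f y) : R^o) x).

Definition cint (R : realType) (a b : R) (f : R -> R[i]) : R[i] :=
  Complex (\int[lebesgue_measure]_(x in `[a, b]) complex.Re (f x))
          (\int[lebesgue_measure]_(x in `[a, b]) complex.Im (f x)).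

(* Integral of [f [:: t_1; ...; t_n]] over a <= t_1 <= ... <= t_n <= b. *)
Fixpoint simplex_int (R : realType) (n : nat) (a b : R)
    (f : seq R -> R[i]) : R[i] :=
  if n is n'.+1 then
    cint a b (fun t => simplex_int n' t b (fun ts => f (t :: ts)))
  else f [::].

Record chart (R : realType) (n : nat) (T : topologicalType) := Chart {
  chart_dom : set T;
  chart_fwd : T -> 'rV[R]_n;
  chart_bwd : 'rV[R]_n -> T;
  chart_dom_open : open chart_dom;
  chart_cod_open : open (chart_fwd @` chart_dom);
  chart_fwdK : forall x, chart_dom x -> chart_bwd (chart_fwd x) = x;
  chart_fwd_cont : forall x, chart_dom x -> {for x, continuous chart_fwd};
  chart_bwd_cont : forall z, (chart_fwd @` chart_dom) z ->
    {for z, continuous chart_bwd}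
}.

(* The atlas is indexed by the points of the manifold. *)
Record manifold (R : realType) (n : nat) := Manifold {
  mcarrier :> topologicalType;
  chart_at : mcarrier -> chart R n mcarrier;
  mem_chart_at : forall x, chart_dom (chart_at x) x;
  manifold_hausdorff : hausdorff_space mcarrier;
  manifold_second_countable : @second_countable mcarrier;
  manifold_compat : forall x y z : mcarrier,
    chart_dom (chart_at x) z -> chart_dom (chart_at y) z ->
    smooth_at (chart_fwd (chart_at y) \o chart_bwd (chart_at x))
              (chart_fwd (chart_at x) z)
}.

Section Manifold.
Variables (R : realType) (n : nat) (M : manifold R n).

Definition fwd (x : M) : M -> 'rV[R]_n := chart_fwd (chart_at x).
Definition bwd (x : M) : 'rV[R]_n -> M := chart_bwd (chart_at x).

(* A tangent vector at [x] is represented by its coordinates in [chart_at x].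
   [tchange x y z w] turns the coordinates in [chart_at x] of a tangent vector
   at the point [z] into its coordinates in [chart_at y]. *)
Definition tchange (x y z : M) (w : 'rV[R]_n) : 'rV[R]_n :=
  'D_w (fwd y \o bwd x) (fwd x z).

Definition vfield_smooth_at (X : M -> 'rV[R]_n) (x : M) : Prop :=
  smooth_at ((fun y => tchange y x y (X y)) \o bwd x) (fwd x x).

Definition mcsmooth_at (f : M -> R[i]) (x : M) : Prop :=
  csmooth_at (f \o bwd x) (fwd x x).

Definition mmxsmooth_at (p q : nat) (F : M -> 'M[R[i]]_(p, q)) (x : M) : Prop :=
  forall i j, mcsmooth_at (fun y => F y i j) x.

Definition mcderive (f : M -> R[i]) (x : M) (v : 'rV[R]_n) : R[i] :=
  cderive (f \o bwd x) (fwd x x) v.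

Definition msmooth_at (V : normedModType R) (c : V -> M) (u : V) : Prop :=
  {for u, continuous c} /\ smooth_at (fwd (c u) \o c) u.

End Manifold.

Record loctriv (R : realType) (n : nat) (M : manifold R n)
    (F : M -> lmodType R[i]) (r : nat) := LocTriv {
  tdom : set M;
  tmap : forall x, F x -> 'cV[R[i]]_r;
  tinv : forall x, 'cV[R[i]]_r -> F x;
  tdom_open : open tdom;
  tmap_linear : forall x, tdom x -> linear (@tmap x);
  tmapK : forall x, tdom x -> cancel (@tmap x) (@tinv x);
  tinvK : forall x, tdom x -> cancel (@tinv x) (@tmap x)
}.
Arguments tmap {R n M F r} l x _.
Arguments tinv {R n M F r} l x _.

Section LocTriv.
Variables (R : realType) (n : nat) (M : manifold R n).
Variable (F : M -> lmodType R[i]).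

(* The transition function g_{phi psi}: coordinates in [psi] are mapped to
   coordinates in [phi]. *)
Definition trans_mx (r r' : nat) (phi : loctriv F r) (psi : loctriv F r')
    (x : M) : 'M[R[i]]_(r, r') :=
  \matrix_(k, l) tmap phi x (tinv psi x (delta_mx l 0)) k 0.

Definition triv_compat (r r' : nat) (phi : loctriv F r) (psi : loctriv F r') :=
  forall x, tdom phi x -> tdom psi x ->
    mmxsmooth_at (trans_mx phi psi) x /\ mmxsmooth_at (trans_mx psi phi) x.

End LocTriv.

(* The rank is only locally constant. *)
Record vbundle (R : realType) (n : nat) (M : manifold R n) := VBundle {
  fiber :> M -> lmodType R[i];
  triv_rank : M -> nat;
  triv_at : forall x, loctriv fiber (triv_rank x);
  mem_triv_at : forall x, tdom (triv_at x) x;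
  vbundle_compat : forall x y, triv_compat (triv_at x) (triv_at y)
}.

Section Bundle.
Variables (R : realType) (n : nat) (M : manifold R n) (E : vbundle M).

Definition smooth_triv (r : nat) (phi : loctriv E r) : Prop :=
  forall x, triv_compat phi (triv_at E x).

Definition section_smooth_at (sigma : forall y, E y) (x : M) : Prop :=
  mmxsmooth_at (fun y => tmap (triv_at E x) y (sigma y)) x.

(* [nabla x v sigma] is the covariant derivative at [x] of [sigma] along [v].
   It is meaningful for sections [sigma] smooth near [x]; other values are set
   to 0, so that two connections are equal iff they agree on smooth sections.
   Smoothness is only required near [x], and so is the smoothness of [f] in the
   Leibniz rule, which therefore also forces [nabla] to be local. *)
Record connection := Connection {
  nabla : forall x : M, 'rV[R]_n -> (forall y, E y) -> E x;
  nabla_junk : forall x v sigma, ~ section_smooth_at sigma x ->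
    nabla x v sigma = 0;
  nabla_linear : forall x sigma (a : R) v w,
    nabla x (a *: v + w) sigma =
    (Complex a 0) *: nabla x v sigma + nabla x w sigma;
  nabla_additive : forall x v sigma tau,
    section_smooth_at sigma x -> section_smooth_at tau x ->
    nabla x v (fun y => sigma y + tau y) = nabla x v sigma + nabla x v tau;
  nabla_leibniz : forall x v (f : M -> R[i]) sigma,
    mcsmooth_at f x -> section_smooth_at sigma x ->
    nabla x v (fun y => f y *: sigma y) =
    mcderive f x v *: sigma x + f x *: nabla x v sigma;
  nabla_smooth : forall x X sigma,
    vfield_smooth_at X x -> section_smooth_at sigma x ->
    section_smooth_at (fun y => nabla y (X y) sigma) x
}.

(* The connection matrix A of 1-forms: nabla e_l = sum_k A_kl e_k for the frame
   e_1, ..., e_r of [phi]. *)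
Definition conn_mx (r : nat) (phi : loctriv E r) (D : connection) (x : M)
    (v : 'rV[R]_n) : 'M[R[i]]_r :=
  \matrix_(k, l)
    tmap phi x (nabla D x v (fun y => tinv phi y (delta_mx l 0))) k 0.

(* dA (v, w) = v (A W) - w (A V), where V and W are the vector fields extending
   v and w with constant coordinates in [chart_at x]. *)
Definition conn_mx_d (r : nat) (phi : loctriv E r) (D : connection) (x : M)
    (v w : 'rV[R]_n) : 'M[R[i]]_r :=
  let A (u : 'rV[R]_n) (y : M) := conn_mx phi D y (tchange x y y u) in
  \matrix_(k, l)
    (mcderive (fun y => A w y k l) x v - mcderive (fun y => A v y k l) x w).

Definition curvature (r : nat) (phi : loctriv E r) (D : connection) (x : M)
    (v w : 'rV[R]_n) : 'M[R[i]]_r :=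
  conn_mx_d phi D x v w +
  (conn_mx phi D x v *m conn_mx phi D x w -
   conn_mx phi D x w *m conn_mx phi D x v).

(* Joint smoothness in the parameter and the point of [M]. *)
Definition smooth_path (D : R -> connection) : Prop :=
  forall (s : R) (x : M) (X : M -> 'rV[R]_n) (sigma : forall y, E y),
    vfield_smooth_at X x -> section_smooth_at sigma x ->
    forall k, csmooth_at
      (fun sz : R^o * 'rV[R]_n => let y := bwd x sz.2 in
        tmap (triv_at E x) y (nabla (D sz.1) y (X y) sigma) k 0)
      (s, fwd x x).

(* 0 = s_0 < s_1 < ... < s_m = 1, and [D] is smooth on each [s_i, s_(i+1)], that
   is, the restriction of a smooth path; values outside [0, 1] are irrelevant. *)
Definition piecewise_smooth_path (D : R -> connection) : Prop :=
  exists ss : seq R, [/\ path <%R 0 ss, last 0 ss = 1 &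
    forall i, (i < size ss)%N -> exists D' : R -> connection,
      smooth_path D' /\
      forall s, nth 0 (0 :: ss) i <= s <= nth 0 ss i -> D s = D' s].

Definition conn_mx_ds (r : nat) (phi : loctriv E r) (D : R -> connection)
    (s : R) (x : M) (v : 'rV[R]_n) : 'M[R[i]]_r :=
  \matrix_(k, l)
    cderive (fun s' : R^o => conn_mx phi (D s') x v k l) (s : R^o) (1 : R^o).

End Bundle.

Section LoopSpace.
Variables (R : realType) (n : nat) (M : manifold R n).

Record loop := Loop {
  loop_fun :> R -> M;
  loop_periodic : forall t, loop_fun (t + 1) = loop_fun t;
  loop_smooth : forall t, msmooth_at (loop_fun : R^o -> M) t
}.

(* Vectors along a loop: the value at [t] is a tangent vector at the point at
   time [t] of the loop. *)
Definition lvec := R -> 'rV[R]_n.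

(* The tangent space of the loop space at [gamma]. *)
Definition tangent (gamma : loop) (v : lvec) : Prop :=
  (forall t, v (t + 1) = v t) /\
  (forall t, smooth_at
     (fun s : R^o => tchange (gamma s) (gamma t) (gamma s) (v s)) (t : R^o)).

Definition velocity (gamma : loop) : lvec :=
  fun t => 'D_(1 : R^o) (fwd (gamma t) \o (gamma : R^o -> M)) (t : R^o).

Definition smooth_family (m : nat) (c : 'rV[R]_m -> loop) : Prop :=
  forall u (t : R^o),
    msmooth_at (fun ut : 'rV[R]_m * R^o => c ut.1 ut.2) (u, t).

Definition dfamily (m : nat) (c : 'rV[R]_m -> loop) (u : 'rV[R]_m)
    (i : 'I_m) : lvec :=
  fun t => 'D_(delta_mx 0 i) (fun w => fwd (c u t) (c w t)) u.

(* An inhomogeneous form, with possibly infinitely many nonzero components: its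
   degree k component at [gamma] is its restriction to lists of k vectors. Only
   the values on lists of tangent vectors are meaningful. *)
Definition lform := loop -> seq lvec -> R[i].

Definition all_tangent (gamma : loop) (vs : seq lvec) : Prop :=
  forall i, (i < size vs)%N -> tangent gamma (nth 0 vs i).

(* Smoothness is tested along smooth finite-dimensional families of loops, which
   on the Frechet manifold of loops is equivalent to smoothness. *)
Record is_form (omega : lform) : Prop := IsForm {
  form_multilinear : forall gamma us v w vs (a : R),
    all_tangent gamma (us ++ v :: w :: vs) ->
    omega gamma (us ++ (a *: v + w) :: vs) =
    Complex a 0 * omega gamma (us ++ v :: vs) + omega gamma (us ++ w :: vs);
  form_alternating : forall gamma vs i j, all_tangent gamma vs ->
    (i < j < size vs)%N -> nth 0 vs i = nth 0 vs j -> omega gamma vs = 0;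
  form_smooth : forall m (c : 'rV[R]_m -> loop) (js : seq 'I_m) u,
    smooth_family c ->
    csmooth_at (fun w => omega (c w) [seq dfamily c w j | j <- js]) u
}.

Definition form_eq (omega eta : lform) : Prop :=
  forall gamma vs, all_tangent gamma vs -> omega gamma vs = eta gamma vs.

(* [form_parity false]: even forms; [form_parity true]: odd forms. *)
Definition form_parity (b : bool) (omega : lform) : Prop :=
  forall gamma vs, all_tangent gamma vs -> odd (size vs) != b ->
    omega gamma vs = 0.

Definition form_add (omega eta : lform) : lform :=
  fun gamma vs => omega gamma vs + eta gamma vs.

Definition contraction (omega : lform) : lform :=
  fun gamma vs => omega gamma (velocity gamma :: vs).

(* [eta] is the exterior derivative of [omega]. Every m tangent vectors at a
   loop are of the form [dfamily c u 0, ..., dfamily c u (m-1)] for some smooth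
   family [c], and the coordinate vector fields of a family commute. *)
Definition is_extd (omega eta : lform) : Prop :=
  forall m (c : 'rV[R]_m -> loop) u, smooth_family c ->
    eta (c u) [seq dfamily c u j | j <- enum 'I_m] =
    \sum_(i < m) (-1) ^+ i *
      cderive (fun w => omega (c w)
                 [seq dfamily c w j | j <- enum 'I_m & j != i])
              u (delta_mx 0 i).

(* The even / odd part of the kernel of (d + iota)^2 = d iota + iota d. *)
Definition Omega_S1 (b : bool) (omega : lform) : Prop :=
  [/\ is_form omega, form_parity b omega &
      exists d_omega di_omega : lform,
        [/\ is_form d_omega, is_extd omega d_omega,
            is_form di_omega, is_extd (contraction omega) di_omega &
            form_eq (form_add di_omega (contraction d_omega)) (fun _ _ => 0)]].

Definition d_iota_exact (omega : lform) : Prop :=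
  exists H d_H : lform, [/\ Omega_S1 false H, is_form d_H, is_extd H d_H &
    form_eq omega (form_add d_H (contraction H))].

End LoopSpace.

Section MForm.
Variables (R : realType) (V : Type) (r : nat).

(* Inhomogeneous matrix-valued alternating forms, as in [lform]. *)
Definition mform := seq V -> 'M[R[i]]_r.

Definition mform0 (A : 'M[R[i]]_r) : mform :=
  fun vs => if vs is [::] then A else 0.
Definition mform1 (A : V -> 'M[R[i]]_r) : mform :=
  fun vs => if vs is [:: v] then A v else 0.
Definition mform2 (A : V -> V -> 'M[R[i]]_r) : mform :=
  fun vs => if vs is [:: v; w] then A v w else 0.

Definition permute (vs : seq V) (s : 'S_(size vs)) : seq V :=
  [seq tnth (in_tuple vs) (s i) | i <- enum 'I_(size vs)].

(* Normalized so that (a /\ b)(v, w) = a v * b w - a w * b v on 1-forms. *)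
Definition wedge (alpha beta : mform) : mform := fun vs =>
  \sum_(a < (size vs).+1) (a`! * (size vs - a)`!)%:R^-1 *:
    \sum_(s : 'S_(size vs)) (-1) ^+ s *:
      (alpha (take a (permute s)) *m beta (drop a (permute s))).

End MForm.

Section BCS.
Variables (R : realType) (n : nat) (M : manifold R n) (E : vbundle M).
Variables (D : R -> connection E) (s : R).
Variables (r p : nat) (phi : 'I_p -> loctriv E r) (gamma : loop M).

(* Indices run from 0: the r-th interval of the subdivision of [0, 1] is the
   one from [node i] to [node i.+1] with i = r - 1. *)
Definition node (i : nat) : R := i%:R / p%:R.

Definition in_nbhd : Prop :=
  forall (i : 'I_p) t, node i <= t <= node i.+1 -> tdom (phi i) (gamma t).

Section Term.
(* [N] is a strict upper bound of the [nn i]. *)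
Variables (N : nat) (nn : {ffun 'I_p -> 'I_N}).
Variables (J : {set 'I_p * 'I_N}) (qm : 'I_p * 'I_N).

Definition bcs_index_set : {set 'I_p * 'I_N} :=
  [set ij : 'I_p * 'I_N | (ij.2 < nn ij.1)%N]%SET.

Definition bcs_X (i : 'I_p) (j : 'I_N) (t : R) : mform R (lvec R n) r :=
  if (i, j) \in J then
    mform2 (fun v w => curvature (phi i) (D s) (gamma t) (v t) (w t))
  else if (i, j) == qm then
    mform1 (fun v => conn_mx_ds (phi i) D s (gamma t) (v t))
  else mform0 (conn_mx (phi i) (D s) (gamma t) (velocity gamma t)).

Definition bcs_I (i : 'I_p) : mform R (lvec R n) r := fun vs =>
  \matrix_(a, b) simplex_int (nn i) (node i) (node i.+1) (fun ts =>
    (\big[@wedge R (lvec R n) r/mform0 1%:M]_(j < N | (j < nn i)%N)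
        bcs_X i j (nth 0 ts j)) vs a b).

(* [ord_pred] is cyclic. *)
Definition bcs_term : mform R (lvec R n) r :=
  \big[@wedge R (lvec R n) r/mform0 1%:M]_(i < p)
    wedge (mform0 (trans_mx (phi (ord_pred i)) (phi i) (gamma (node i))))
          (bcs_I i).

End Term.

(* The part of the degree 2k+1 integrand with n_1, ..., n_p < N. *)
Definition bcs_partial_sum (k N : nat) (vs : seq (lvec R n)) : 'M[R[i]]_r :=
  \sum_(nn : {ffun 'I_p -> 'I_N})
    \sum_(J : {set 'I_p * 'I_N} | (J \subset bcs_index_set nn) && (#|J| == k))
      \sum_(qm in (bcs_index_set nn :\: J)%SET) bcs_term nn J qm vs.

End BCS.

Section BCSEquivalence.
Variables (R : realType) (n : nat) (M : manifold R n) (E : vbundle M).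

Definition mx_cvg (r : nat) (u : nat -> 'M[R[i]]_r) (L : 'M[R[i]]_r) : Prop :=
  forall a b,
    (fun N => complex.Re (u N a b) : R^o) @ \oo --> (complex.Re (L a b) : R^o) /\
    (fun N => complex.Im (u N a b) : R^o) @ \oo --> (complex.Im (L a b) : R^o).

Definition mx_integrable (r : nat) (F : R -> 'M[R[i]]_r) : Prop :=
  forall a b,
    lebesgue_measure.-integrable `[(0 : R), 1]
      (EFin \o (fun s => complex.Re (F s a b))) /\
    lebesgue_measure.-integrable `[(0 : R), 1]
      (EFin \o (fun s => complex.Im (F s a b))).

Definition mx_int (r : nat) (F : R -> 'M[R[i]]_r) : 'M[R[i]]_r :=
  \matrix_(a, b) cint 0 1 (fun s => F s a b).

(* [omega] is the Bismut-Chern-Simons form of [D]: its value is given by the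
   integral over [0, 1] of [F s], the sum of the series, for all choices of
   local trivializations and subdivisions. The s-derivative of [D] may not exist
   at finitely many [s]. The local trivializations along a loop have the same
   rank r. *)
Definition is_BCS (D : R -> connection E) (omega : lform M) : Prop :=
  form_parity true omega /\
  forall (gamma : loop M) (r p : nat) (phi : 'I_p -> loctriv E r)
         (k : nat) (vs : seq (lvec R n)),
    (0 < p)%N -> (forall i, smooth_triv (phi i)) -> in_nbhd phi gamma ->
    size vs = k.*2.+1 -> all_tangent gamma vs ->
    exists F : R -> 'M[R[i]]_r,
      [/\ {ae @lebesgue_measure R, forall s, s \in `[(0 : R), 1] ->
             mx_cvg (fun N => bcs_partial_sum D s phi gamma k N vs) (F s)},
          mx_integrable F &
          omega gamma vs = \tr (mx_int F)].

Definition BCS_equivalent (D0 D1 : connection E) : Prop :=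
  exists (D : R -> connection E) (omega : lform M),
    [/\ piecewise_smooth_path D, D 0 = D0 /\ D 1 = D1,
        Omega_S1 true omega, is_BCS D omega & d_iota_exact omega].

End BCSEquivalence.

(* Main.v *)
From mathcomp Require Import all_boot all_order all_algebra.
From mathcomp Require Import all_classical all_reals all_analysis.
From mathcomp Require Import measurable_realfun complex ring lra.
Require Import Defs.

(** Constant paths, reversed paths and concatenated paths have as BCS forms
    [0], [- BCS] and [BCS + BCS']: under an affine reparametrization with slope
    [c] the only factor of the integrand that changes is the single [A'], which
    is multiplied by [c], and the substitution in the outer integral divides by
    [|c|].  So the BCS forms need not be shown to exist: it suffices that the
    multiple-integral formula is homogeneous in that factor, whether or not the
    integrands are measurable.  Exactness is inherited because [d + iota] is
    linear.  For [d iota] this requires contractions of smooth forms to be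
    differentiable along smooth families of loops, which follows by adding to a
    family the rotations of its loops as one more parameter. *)

Set Implicit Arguments.
Unset Strict Implicit.
Unset Printing Implicit Defensive.

Import Order.TTheory GRing.Theory Num.Theory.
Import numFieldNormedType.Exports.

Local Open Scope classical_set_scope.
Local Open Scope ring_scope.

(** * Derivatives and smoothness under affine maps and real linear combinations *)

Section Smoothness.
Context {R : realType}.

Lemma Re_realM (c : R) (z : R[i]) :
  complex.Re (Complex c 0 * z) = c * complex.Re z.
Proof. by case: z => x y /=; rewrite mul0r subr0. Qed.

Lemma Im_realM (c : R) (z : R[i]) :
  complex.Im (Complex c 0 * z) = c * complex.Im z.
Proof. by case: z => x y /=; rewrite mul0r addr0. Qed.

Lemma realM_Complex (c x y : R) :
  Complex c 0 * Complex x y = Complex (c * x) (c * y).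
Proof. by apply/eqP; rewrite eq_complex Re_realM Im_realM /= !eqxx. Qed.

Lemma Re_lin (a : R) (z w : R[i]) :
  complex.Re (Complex a 0 * z + w) = a * complex.Re z + complex.Re w.
Proof. by rewrite raddfD /= Re_realM. Qed.

Lemma Im_lin (a : R) (z w : R[i]) :
  complex.Im (Complex a 0 * z + w) = a * complex.Im z + complex.Im w.
Proof. by rewrite raddfD /= Im_realM. Qed.

(** Multiplication by [c] and by its inverse both preserve punctured neighbourhoods of 0. An
    equality of filters, unlike a convergence statement, also transports limits that may fail to
    exist. *)
Lemma dnbhs0_scale (c : R) : c != 0 -> ( *%R c @ 0^') = (0^' : set_system R).
Proof.
have sub (a : R) : a != 0 -> *%R a @ 0^' --> 0^'.
  move=> a0 A /nbhs_ballP[e /= e0 eA].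
  apply/(@nbhs_ballP _ R); exists (e / `|a|) => /=;
    first by rewrite divr_gt0 ?normr_gt0.
  move=> h; rewrite /ball/= sub0r normrN => he h0.
  apply: eA; last by rewrite mulf_neq0.
  by rewrite /ball/= sub0r normrN normrM mulrC -ltr_pdivlMr ?normr_gt0.
move=> c0; apply/seteqP; split; last exact: sub.
move=> A /= cA; have /= := sub _ (invr_neq0 c0) _ cA; rewrite !nbhs_simpl /=.
rewrite (_ : _ @^-1` _ = A)//.
by apply/funext => h /=; rewrite mulrA mulfV// mul1r.
Qed.

(* No convergence is needed: a limit that does not exist is 0. *)
Lemma limZ_dvg (F : set_system R^o) (c : R) : ProperFilter F ->
  c != 0 -> lim ((fun z : R^o => c *: z : R^o) @ F) = c * lim F.
Proof.
move=> PF c0; have [cF|dF] := pselect (cvg F).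
  exact: (@limZl_tmp _ _ _ F _ c idfun cF).
have dcF : ~ cvg ((fun z : R^o => c *: z : R^o) @ F).
  by rewrite (@is_cvgZlE _ R^o _ F _ c idfun c0).
by rewrite (dvgP dF) (dvgP dcF) mulr0.
Qed.

(** The difference quotient of [f] at [h] is [c] times that of [g] at [c * h], and for nonzero [c]
    this change of variable preserves the filter at 0. For [c = 0] the function [f] is constant on
    the line. If [c] is nonzero and the derivative of [g] does not exist, both sides are the default
    value 0. *)
Lemma derive_scale (V W : normedModType R) (f : V -> R^o) (g : W -> R^o)
    (x v : V) (y w : W) (c : R) :
  (forall h, f (h *: v + x) = g ((c * h) *: w + y)) ->
  'D_v f x = c * 'D_w g y.
Proof.
move=> fg.
have fg0 : f x = g y by have := fg 0; rewrite mulr0 !scale0r !add0r.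
have [c0|c0] := eqVneq c 0.
  rewrite c0 mul0r /derive (_ : (fun h => _) = cst 0) ?lim_cst//.
  by apply/funext => h /=; rewrite fg fg0 c0 mul0r scale0r add0r subrr scaler0.
pose q (h : R) : R^o := h^-1 *: ((g \o shift y) (h *: w) - g y).
have quotientE : (fun h : R => h^-1 *: ((f \o shift x) (h *: v) - f x)) =
    (fun z : R^o => c *: z : R^o) \o (q \o ( *%R c)).
  apply/funext => h /=; rewrite fg fg0 /q /GRing.scale /= invfM.
  by rewrite !mulrA mulfV// mul1r.
rewrite /derive quotientE (fmap_comp (fun z : R^o => c *: z : R^o)).
by rewrite (fmap_comp q) dnbhs0_scale// limZ_dvg.
Qed.

Lemma continuous_pair (T U V : topologicalType) (f : T -> U) (g : T -> V) :
  continuous f -> continuous g -> continuous (fun x => (f x, g x)).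
Proof. by move=> cf cg x; exact: cvg_pair (cf x) (cg x). Qed.

Lemma Ck_on_subset (V W : normedModType R) k (U U' : set V) (f : V -> W) :
  U' `<=` U -> Ck_on k U f -> Ck_on k U' f.
Proof.
move=> sU; elim: k f => [|k IH] f /= [cf df].
  by split=> // x /sU; exact: cf.
split=> [x /sU|v]; first exact: cf.
by have [dfv ckv] := df v; split=> [x /sU|]; [exact: dfv|exact: IH].
Qed.

Lemma eq_Ck_on (V W : normedModType R) k (U : set V) (f g : V -> W) :
  open U -> {in U, f =1 g} -> Ck_on k U f -> Ck_on k U g.
Proof.
move=> oU; elim: k f g => [|k IH] f g fg /= [cf df].
  split=> // x Ux; rewrite /prop_for/continuous_at -fg ?inE//.
  apply: cvg_trans (cf x Ux); apply: near_eq_cvg.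
  by near=> y; apply: fg; rewrite inE; near: y; exact: open_nbhs_nbhs.
have nfg x : U x -> {near x, f =1 g}.
  by move=> Ux; near=> y; apply: fg; rewrite inE; near: y;
    exact: open_nbhs_nbhs.
split=> [x Ux|v].
  rewrite /prop_for/continuous_at -fg ?inE//.
  by apply: cvg_trans (cf x Ux); apply: near_eq_cvg; exact: nfg.
have [dfv ckv] := df v; split=> [x Ux|].
  exact: near_eq_derivable (nfg x Ux) (dfv x Ux).
apply: IH ckv => x /set_mem Ux; apply: near_eq_derive; exact: nfg.
Unshelve. all: by end_near. Qed.

(** [L0] is the linear part of [L]. The difference quotients of [f \o L] along [v] are those of [f]
    along [L0 v], so a directional derivative of [f \o L] is one of [f] composed with [L], and
    induction on [k] applies. *)
Lemma Ck_on_comp_affine (V V' W : normedModType R) k (U : set V')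
    (L : V -> V') (L0 : V -> V') (f : V' -> W) :
  continuous L -> (forall h v x, L (h *: v + x) = h *: L0 v + L x) ->
  Ck_on k U f -> Ck_on k (L @^-1` U) (f \o L).
Proof.
move=> cL aff; elim: k f => [|k IH] f /= [cf df].
  by split=> // x Ux; apply: continuous_comp; [exact: cL|exact: cf].
have quotientE x v : (fun h : R =>
  h^-1 *: ((f \o L \o shift x) (h *: v) - (f \o L) x)) =
    (fun h : R => h^-1 *: ((f \o shift (L x)) (h *: L0 v) - f (L x))).
  by apply/funext => h /=; rewrite aff.
split=> [x Ux|v]; first by apply: continuous_comp; [exact: cL|exact: cf].
have [dfv ckv] := df (L0 v); split=> [x Ux|].
  by rewrite /derivable quotientE; exact: dfv.
rewrite (_ : 'D_v (f \o L) = 'D_(L0 v) f \o L); first exact: IH.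
by apply/funext => x; rewrite /derive quotientE.
Qed.

Lemma smooth_at_comp_affine (V V' W : normedModType R) (L : V -> V')
    (L0 : V -> V') (f : V' -> W) (x : V) :
  continuous L -> (forall h v y, L (h *: v + y) = h *: L0 v + L y) ->
  smooth_at f (L x) -> smooth_at (f \o L) x.
Proof.
move=> cL aff [U [oU Ux ck]]; exists (L @^-1` U); split => // [|k].
  by apply: open_comp => // y _; exact: cL.
exact: Ck_on_comp_affine.
Qed.

Lemma csmooth_at_comp_affine (V V' : normedModType R) (L : V -> V')
    (L0 : V -> V') (f : V' -> R[i]) (x : V) :
  continuous L -> (forall h v y, L (h *: v + y) = h *: L0 v + L y) ->
  csmooth_at f (L x) -> csmooth_at (f \o L) x.
Proof.
move=> cL aff [fr fi]; split.
  exact: (smooth_at_comp_affine cL aff fr).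
exact: (smooth_at_comp_affine cL aff fi).
Qed.

Lemma derive_lin (V W : normedModType R) (a : R) (f g : V -> W) (x v : V) :
  derivable f x v -> derivable g x v ->
  'D_v (fun y => a *: f y + g y) x = a *: 'D_v f x + 'D_v g x.
Proof.
by move=> df dg; have := deriveD (derivableZ (k := a) df) dg; rewrite deriveZ.
Qed.

Lemma Ck_on_lin (V W : normedModType R) k (U : set V) (a : R) (f g : V -> W) :
  open U -> Ck_on k U f -> Ck_on k U g ->
  Ck_on k U (fun x => a *: f x + g x).
Proof.
move=> oU; elim: k f g => [|k IH] f g /= [cf df] [cg dg].
  by split=> // x Ux; exact: continuousD (continuousZl_tmp (cf _ Ux)) (cg _ Ux).
split=> [x Ux|v]; first by exact: continuousD (continuousZl_tmp (cf _ Ux)) (cg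
  _ Ux).
have [dfv ckfv] := df v; have [dgv ckgv] := dg v; split=> [x Ux|].
  exact: derivableD (derivableZ (k := a) (dfv _ Ux)) (dgv _ Ux).
apply: (eq_Ck_on oU _ (IH _ _ ckfv ckgv)) => x /set_mem Ux.
by rewrite derive_lin; [|exact: dfv|exact: dgv].
Qed.

Lemma smooth_at_lin (V W : normedModType R) (a : R) (f g : V -> W) (x : V) :
  smooth_at f x -> smooth_at g x -> smooth_at (fun y => a *: f y + g y) x.
Proof.
move=> [U [oU Ux fU]] [U' [oU' Ux' gU]]; exists (U `&` U'); split=> //.
  exact: openI.
by move=> k; apply: Ck_on_lin; [exact: openI|
  exact: Ck_on_subset (@subIsetl _ _ _) _|exact: Ck_on_subset (@subIsetr _ _
    _) _].
Qed.

Lemma csmooth_at_lin (V : normedModType R) (a : R) (f g : V -> R[i]) (x : V) :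
  csmooth_at f x -> csmooth_at g x ->
  csmooth_at (fun y => Complex a 0 * f y + g y) x.
Proof.
move=> [fr fi] [gr gi]; split.
  have -> : (fun y => complex.Re (Complex a 0 * f y + g y) : R^o) =
      (fun y => a *: (complex.Re (f y) : R^o) + complex.Re (g y)).
    by apply/funext => y; rewrite Re_lin.
  exact: smooth_at_lin.
have -> : (fun y => complex.Im (Complex a 0 * f y + g y) : R^o) =
    (fun y => a *: (complex.Im (f y) : R^o) + complex.Im (g y)).
  by apply/funext => y; rewrite Im_lin.
exact: smooth_at_lin.
Qed.

Lemma smooth_at_derivable (V W : normedModType R) (f : V -> W) (x v : V) :
  smooth_at f x -> derivable f x v.
Proof. by move=> [U [_ Ux /(_ 1%N)[_ /(_ v)[df _]]]]; exact: df. Qed.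

Lemma smooth_at_cst (V W : normedModType R) (a : W) (x : V) :
  smooth_at (cst a) x.
Proof.
exists setT; split=> //; first exact: openT.
move=> k; elim: k a => [|k IH] a /=; first by split=> // y _; exact: cvg_cst.
split=> [y _|v]; first exact: cvg_cst.
split=> [y _|]; first exact: derivable_cst.
by rewrite (_ : 'D_v (cst a) = cst 0)//; apply/funext => y; exact: derive_cst.
Qed.

Lemma cderive_lin (V : normedModType R) (a : R) (f g : V -> R[i]) (x v : V) :
  csmooth_at f x -> csmooth_at g x ->
  cderive (fun y => Complex a 0 * f y + g y) x v =
  Complex a 0 * cderive f x v + cderive g x v.
Proof.
move=> [fr fi] [gr gi]; rewrite /cderive.
have -> : (fun y => complex.Re (Complex a 0 * f y + g y) : R^o) =
    (fun y => a *: (complex.Re (f y) : R^o) + complex.Re (g y)).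
  by apply/funext => y; rewrite Re_lin.
have -> : (fun y => complex.Im (Complex a 0 * f y + g y) : R^o) =
    (fun y => a *: (complex.Im (f y) : R^o) + complex.Im (g y)).
  by apply/funext => y; rewrite Im_lin.
by rewrite !derive_lin; try exact: smooth_at_derivable; rewrite realM_Complex.
Qed.

Lemma cderive_cst (V : normedModType R) (a : R[i]) (x v : V) :
  cderive (fun=> a) x v = 0.
Proof. by rewrite /cderive !derive_cst. Qed.

End Smoothness.

(** * Homogeneity of the integral for arbitrary functions *)

Section NonmeasurableIntegral.
Context d (T : measurableType d) (R : realType) (m : {measure set T -> \bar R}).
Import HBNNSimple.
Local Open Scope ereal_scope.

(** The supremum that defines the integral of a nonnegative function; it makes sense for every
    function. *)
Let nnint (f : T -> \bar R) := ereal_sup [set sintegral m h |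
  h in [set h : {nnsfun T >-> R} | forall x, (h x)%:E <= f x]].

Let nnint_ge0 (f : T -> \bar R) : (forall x, 0 <= f x) -> 0 <= nnint f.
Proof.
move=> f0; apply: ereal_sup_ubound; exists (cst_nnsfun T (NngNum (lexx 0%R))).
  by move=> x; exact: f0.
by rewrite sintegral0.
Qed.

(** If the simple function [h] lies below [f], then [k * h] lies below [k * f]. *)
Let nnintZ_le (f : T -> \bar R) (k : R) : (0 < k)%R ->
  k%:E * nnint f <= nnint (fun x => k%:E * f x).
Proof.
move=> k0; rewrite -lee_pdivlMl//; apply: ge_ereal_sup => _ [h hf <-].
rewrite lee_pdivlMl// -sintegralrM; apply: ereal_sup_ubound => /=.
exists (scale_nnsfun h (ltW k0)) => // x /=.
by rewrite EFinM lee_pmul2l// lte_fin.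
Qed.

Let nnintZ (f : T -> \bar R) (k : R) : (0 < k)%R ->
  nnint (fun x => k%:E * f x) = k%:E * nnint f.
Proof.
move=> k0; apply/eqP; rewrite eq_le nnintZ_le// andbT.
(* The reverse inequality is the same bound for the factor [k^-1], applied to [k * f]. *)
rewrite -lee_pdivrMl//; have ki : (0 < k^-1)%R by rewrite invr_gt0.
apply: le_trans (nnintZ_le _ ki) _; rewrite (_ : (fun _ => _) = f)//.
by apply/funext => x; rewrite muleA -EFinM mulVf ?gt_eqF// mul1e.
Qed.

(* No measurability is needed: the integral of any function is defined as the
   integral of its positive part minus that of its negative part. *)
Lemma RintegralZ_nonmeasurable (D : set T) (f : T -> R) (k : R) :
  (\int[m]_(x in D) (k * f x) = k * \int[m]_(x in D) f x)%R.
Proof.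
have fE g : (\int[m]_(x in D) g x)%R =
    fine (nnint ((EFin \o g) \_ D)^\+ - nnint ((EFin \o g) \_ D)^\-) by [].
have res g c : (EFin \o (fun x => c * g x)%R) \_ D =
    (fun x => c%:E * ((EFin \o g) \_ D) x).
  by apply/funext => x; rewrite /patch; case: ifP; rewrite ?mule0.
have pos g c : (0 < c)%R ->
    (\int[m]_(x in D) (c * g x) = c * \int[m]_(x in D) g x)%R.
  move=> c0; rewrite !fE res ge0_funeposM ?ltW// ge0_funenegM ?ltW// !nnintZ//.
  (* Nonnegativity leaves finite values and [+oo]. If one of the two is infinite, so is the
     difference, and [fine] sends it to 0 on both sides. *)
  have [] := (nnint_ge0 (funepos_ge0 ((EFin \o g) \_ D)),
              nnint_ge0 (funeneg_ge0 ((EFin \o g) \_ D))).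
  move: (nnint _) (nnint _) => [x| |] [y| |]//= _ _;
    rewrite ?(gt0_muley, gt0_mulye) ?lte_fin//= ?mulr0// ?mulrBr//.
have [k0|k0|->] := ltgtP k 0%R.
(* For negative [k] the positive factor [- k] is treated by [pos]; the remaining factor -1 exchanges
   the positive and the negative part. *)
- rewrite (_ : k = - - k)%R ?opprK//.
  rewrite -[in RHS](opprK k) mulNr -pos ?oppr_gt0//.
  rewrite (_ : (fun x => k * f x) = (fun x => -1 * (- k * f x)))%R; last first.
    by apply/funext => x; rewrite mulN1r mulNr opprK.
  rewrite !fE res le0_funeposM ?le0_funenegM ?lerN10//.
  rewrite (_ : - (-1)%:E = 1); last by rewrite -EFinN opprK.
  have one (g : T -> \bar R) : (fun x => 1 * g x) = g.
    by apply/funext => x; rewrite mul1e.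
  rewrite !one.
  have [] := (nnint_ge0 (funepos_ge0 ((EFin \o (fun x => (- k * f x)%R)) \_ D)),
              nnint_ge0 (funeneg_ge0 ((EFin \o (fun x =>
                (- k * f x)%R)) \_ D))).
  by move: (nnint _) (nnint _) => [x| |] [y| |]//= _ _; rewrite ?oppr0// opprB.
- exact: pos.
- rewrite mul0r (_ : (fun x => (0 * f x)%R) = cst 0%R).
    by rewrite /Rintegral integral0.
  by apply/funext => x; rewrite mul0r.
Qed.

End NonmeasurableIntegral.

(** * Affine substitution for Lebesgue measure on the line *)

Section AffineSubstitution.
Context {R : realType}.
Variables (c d : R).
Hypothesis c0 : c != 0.
Local Notation mu := (@lebesgue_measure R).
Let L : R -> measurableTypeR R := fun x => c * x + d.

Let mL : measurable_fun setT (L : measurableTypeR R -> measurableTypeR R).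
Proof.
apply: measurable_funD => //; exact: measurable_funM.
Qed.

Let preimage_oc (a b : R) : mu (L @^-1` `]a, b]) = (`|c|^-1%:E * mu `]a, b])%E.
Proof.
have [c_gt0|c_le0] := ltrP 0 c.
  rewrite (_ : L @^-1` _ = `](a - d) / c, (b - d) / c]%classic); last first.
    apply/seteqP; split => x /=; rewrite !in_itv /= ltr_pdivrMr// ler_pdivlMr//;
      by rewrite ltrBlDr lerBrDr (mulrC x).
  rewrite !lebesgue_measure_itv /= !lte_fin ltr_pM2r ?invr_gt0// ltrD2r.
  case: ifP => _; last by rewrite mule0.
  by rewrite -!EFinD -EFinM gtr0_norm//; congr EFin; field.
have c_lt0 : c < 0 by rewrite lt_neqAle c0.
(* A negative slope reverses the inequalities, so the closed end of the preimage is the left one. *)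
rewrite (_ : L @^-1` _ = `[(b - d) / c, (a - d) / c[%classic); last first.
  apply/seteqP; split => x /=; rewrite !in_itv /= ltr_ndivlMr// ler_ndivrMr//;
    by rewrite ltrBlDr lerBrDr (mulrC x) andbC.
rewrite !lebesgue_measure_itv /= !lte_fin ltr_nM2r ?invr_lt0// ltrD2r.
case: ifP => _; last by rewrite mule0.
by rewrite -!EFinD -EFinM ltr0_norm//; congr EFin; field.
Qed.

(** Uniqueness of Lebesgue measure: the image of [mu] under [L], multiplied by |c|, gives every
    interval []a, b]] its length. *)
Lemma lebesgue_measure_affine (A : set R) : measurable A ->
  mu A = (`|c|%:E * mu (L @^-1` A))%E.
Proof.
have nc : 0 <= `|c| by [].
move=> mA; rewrite (lebesgue_measure_unique
  (mu := mscale (NngNum nc) (pushforward mu L)))// => _ [[a b]] _ <-.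
rewrite -[RHS]/(`|c|%:E * mu (L @^-1` `]a,
  b]%classic))%E preimage_oc muleA -EFinM mulfV ?mul1e//.
by rewrite normr_eq0.
Qed.

(** The preimage of a null set is null, since |c| times its measure is 0 and [c] is nonzero. *)
Lemma ae_affine (P : R -> Prop) : {ae mu, forall x, P x} ->
  {ae mu, forall x, P (c * x + d)}.
Proof.
move=> [A [mA A0 PA]]; exists (L @^-1` A); split => //.
- by rewrite -[X in measurable X]setTI; exact: mL.
- apply/eqP; have := lebesgue_measure_affine mA; rewrite A0 => /esym/eqP.
  by rewrite mule_eq0 eqe normr_eq0 (negbTE c0).
- by move=> x /= Px; exact: PA.
Qed.

Lemma ge0_integral_affine (D : set R) (f : R -> \bar R) : measurable D ->
  measurable_fun D f -> (forall x, D x -> (0 <= f x)%E) ->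
  (\int[mu]_(x in D) f x = `|c|%:E * \int[mu]_(x in L @^-1` D) f (L x))%E.
Proof.
move=> mD mf f0; have nc : 0 <= `|c| by [].
rewrite (eq_measure_integral (mscale (NngNum nc) (pushforward mu L)));
  last first.
  by move=> A mA _; exact: lebesgue_measure_affine.
rewrite ge0_integral_mscale//= ge0_integral_pushforward//.
by move=> x /set_mem; exact: f0.
Qed.

Let mL_preimage (D : set R) : measurable D -> measurable (L @^-1` D).
Proof. by move=> mD; rewrite -[X in measurable X]setTI; exact: mL. Qed.

Let measurable_fun_affine (D : set R) (f : R -> \bar R) : measurable D ->
  measurable_fun D f -> measurable_fun (L @^-1` D) (f \o L).
Proof.
move=> mD mf; apply: (measurable_comp mD) => //; first by move=> _ [x Dx <-].
exact: measurable_funTS.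
Qed.

Lemma integrable_affine (D : set R) (f : R -> R) : measurable D ->
  mu.-integrable D (EFin \o f) ->
  mu.-integrable ((fun x => c * x + d) @^-1` D)
    (EFin \o (fun x => f (c * x + d))).
Proof.
move=> mD /integrableP[mf]; rewrite (ge0_integral_affine mD)//; last first.
  exact: measurableT_comp.
move=> fi; apply/integrableP; split; first exact: measurable_fun_affine mf.
have c_gt0 : (0 < `|c|%:E)%E by rewrite lte_fin normr_gt0.
rewrite ltNge; apply/negP; rewrite leye_eq => /eqP ioo.
by move: fi; rewrite /= /L ioo gt0_muley.
Qed.

Lemma Rintegral_affine (D : set R) (f : R -> R) : measurable D ->
  mu.-integrable D (EFin \o f) ->
  \int[mu]_(x in D) f x =
  `|c| * \int[mu]_(x in (fun x => c * x + d) @^-1` D) f (c * x + d).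
Proof.
move=> mD fi; have mf := measurable_int _ fi.
have fLi := integrable_affine mD fi.
rewrite /Rintegral -[RHS]/(fine `|c|%:E * _) -fineM//; last first.
  by apply: (integrable_fin_num _ fLi); exact: mL_preimage.
congr fine; rewrite integralE [in RHS]integralE.
rewrite (ge0_integral_affine mD (measurable_funepos mf))//.
rewrite (ge0_integral_affine mD (measurable_funeneg mf))//.
rewrite (_ : (fun x => (EFin \o f)^\+ (L x))%E = (EFin \o (f \o L))^\+%E);
  last first.
  by apply/funext => x; rewrite !funeposE.
rewrite (_ : (fun x => (EFin \o f)^\- (L x))%E = (EFin \o (f \o L))^\-%E);
  last first.
  by apply/funext => x; rewrite !funenegE.
rewrite -muleBr//; apply: fin_num_adde_defr.
by apply: (integrable_pos_fin_num _ fLi); exact: mL_preimage.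
Qed.

End AffineSubstitution.

(** * Homogeneity of the multiple-integral formula in one factor *)

Section Wedge.
Context {R : realType} {V : Type} {r : nat}.
Implicit Types alpha beta : mform R V r.

Definition mform_scale (c : R[i]) alpha : mform R V r := fun vs =>
  c *: alpha vs.

Lemma wedgeZl c alpha beta :
  wedge (mform_scale c alpha) beta = mform_scale c (wedge alpha beta).
Proof.
apply/funext => vs; rewrite /wedge /mform_scale scaler_sumr.
apply: eq_bigr => a _; rewrite scalerA mulrC -scalerA; congr (_ *: _).
rewrite scaler_sumr; apply: eq_bigr => s _.
by rewrite -scalemxAl !scalerA mulrC.
Qed.

Lemma wedgeZr c alpha beta :
  wedge alpha (mform_scale c beta) = mform_scale c (wedge alpha beta).
Proof.
apply/funext => vs; rewrite /wedge /mform_scale scaler_sumr.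
apply: eq_bigr => a _; rewrite scalerA mulrC -scalerA; congr (_ *: _).
rewrite scaler_sumr; apply: eq_bigr => s _.
by rewrite -scalemxAr !scalerA mulrC.
Qed.

(** The product is a fold over the duplicate-free enumeration of [I], in which [q] occurs exactly
    once. Its scalar passes through [wedge] from either side, so induction on the enumeration
    carries it to the front. *)
Lemma big_wedgeZ (I : finType) (P : pred I) (q : I) c (X X' : I -> mform R V
  r) :
  P q -> X' q = mform_scale c (X q) -> (forall i, i != q -> X' i = X i) ->
  \big[@wedge R V r/mform0 1%:M]_(i | P i) X' i =
  mform_scale c (\big[@wedge R V r/mform0 1%:M]_(i | P i) X i).
Proof.
move=> Pq Xq Xi; have := mem_index_enum q; have := index_enum_uniq I.
elim: (index_enum I) => // i s IH /= /andP[ns us].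
rewrite inE !big_cons => /predU1P[qi|qs].
  rewrite -qi Pq Xq wedgeZl; congr (mform_scale _ (wedge _ _)).
  rewrite big_seq_cond [RHS]big_seq_cond; apply: eq_bigr => j /andP[js _].
  by apply: Xi; apply: contraNneq ns => jq; rewrite -qi -jq.
rewrite IH// Xi; last by apply: contraNneq ns => ->.
by case: ifP => // _; rewrite wedgeZr.
Qed.

End Wedge.

Section SimplexIntegral.
Context {R : realType}.

Lemma cintZ (a b c : R) (f : R -> R[i]) :
  cint a b (fun t => Complex c 0 * f t) = Complex c 0 * cint a b f.
Proof.
rewrite /cint.
have -> : (fun x => complex.Re (Complex c 0 * f x)) =
    (fun x => c * complex.Re (f x)) by apply/funext => x; exact: Re_realM.
have -> : (fun x => complex.Im (Complex c 0 * f x)) =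
    (fun x => c * complex.Im (f x)) by apply/funext => x; exact: Im_realM.
by rewrite !RintegralZ_nonmeasurable realM_Complex.
Qed.

Lemma simplex_intZ n (a b c : R) (f : seq R -> R[i]) :
  simplex_int n a b (fun ts => Complex c 0 * f ts) =
  Complex c 0 * simplex_int n a b f.
Proof.
elim: n a f => [//|n IH] a f /=; rewrite -cintZ; congr cint.
by apply/funext => t; rewrite IH.
Qed.

End SimplexIntegral.

Section BCSScale.
Context {R : realType} {n : nat} {M : manifold R n} {E : vbundle M}.
Variables (D D' : R -> connection E) (s s' c : R).
Variables (r p : nat) (phi : 'I_p -> loctriv E r) (gamma : loop M).
Hypothesis DE : D' s' = D s.
Hypothesis dsE : forall i x v,
  conn_mx_ds (phi i) D' s' x v = Complex c 0 *: conn_mx_ds (phi i) D s x v.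

(** The scalar attached to the single factor A' at [(q, m)] leaves the product over [j], then the
    simplex integral of the interval [q], then the product over the intervals. *)
Lemma bcs_termZ N (nn : {ffun 'I_p -> 'I_N}) (J : {set 'I_p * 'I_N})
    (qm : 'I_p * 'I_N) : qm \in (bcs_index_set nn :\: J)%SET ->
  bcs_term D' s' phi gamma nn J qm =
  mform_scale (Complex c 0) (bcs_term D s phi gamma nn J qm).
Proof.
case: qm => q m; rewrite !inE /= => /andP[qmJ mq].
have XE i j t : (i, j) != (q, m) ->
    bcs_X D' s' phi gamma J (q, m) i j t = bcs_X D s phi gamma J (q, m) i j t.
  by move=> /negbTE ij; rewrite /bcs_X DE ij.
have XqE t : bcs_X D' s' phi gamma J (q, m) q m t =
    mform_scale (Complex c 0) (bcs_X D s phi gamma J (q, m) q m t).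
  (* [bcs_X] looks at [J] first, so position [(q, m)] carries A' because it lies outside [J]. *)
  rewrite /bcs_X (negbTE qmJ) eqxx; apply/funext => vs; rewrite /mform_scale.
  by case: vs => [|v [|w vs]] /=; rewrite ?scaler0.
apply: (@big_wedgeZ R _ _ _ _ q) => [//||i iq].
  rewrite -wedgeZr; congr wedge; apply/funext => vs.
  apply/matrixP => a b; rewrite !mxE -simplex_intZ.
  congr simplex_int; apply/funext => ts.
  rewrite (@big_wedgeZ _ _ _ _ _ m (Complex c 0)
    (fun j => bcs_X D s phi gamma J (q, m) q j (nth 0 ts j)))//.
    by rewrite /mform_scale mxE.
  by move=> j jm; apply: XE; rewrite xpair_eqE eqxx.
congr wedge; apply/funext => vs; apply/matrixP => a b; rewrite !mxE.
congr simplex_int; apply/funext => ts.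
rewrite (eq_bigr (fun j : 'I_N =>
  bcs_X D s phi gamma J (q, m) i j (nth 0 ts j)))// => j _.
by apply: XE; rewrite xpair_eqE (negbTE iq).
Qed.

Lemma bcs_partial_sumZ k N vs :
  bcs_partial_sum D' s' phi gamma k N vs =
  Complex c 0 *: bcs_partial_sum D s phi gamma k N vs.
Proof.
rewrite /bcs_partial_sum scaler_sumr; apply: eq_bigr => nn _.
rewrite scaler_sumr; apply: eq_bigr => J _.
rewrite scaler_sumr; apply: eq_bigr => qm qmJ.
by rewrite bcs_termZ.
Qed.

End BCSScale.

Lemma mx_cvgZ (R : realType) r (u : nat -> 'M[R[i]]_r) (L : 'M[R[i]]_r) (c :
  R) :
  mx_cvg u L ->
  mx_cvg (fun N => Complex c 0 *: u N) (Complex c 0 *: L).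
Proof.
move=> uL a b; have [re im] := uL a b; split.
  rewrite mxE Re_realM (_ : (fun N => _) = (fun N =>
    c *: (complex.Re (u N a b) : R^o))).
    exact: cvgZl_tmp.
  by apply/funext => N; rewrite mxE Re_realM.
rewrite mxE Im_realM (_ : (fun N => _) = (fun N =>
  c *: (complex.Im (u N a b) : R^o))).
  exact: cvgZl_tmp.
by apply/funext => N; rewrite mxE Im_realM.
Qed.

(** * Linear combinations of forms on the loop space *)

Section LinearCombinationsOfForms.
Context {R : realType} {n : nat} {M : manifold R n}.
Implicit Types (omega eta : lform M) (a : R).

(** One operation for both constructions: [a = -1] and [eta = form_zero] give the negative, [a = 1]
    the sum. *)
Definition form_lin a omega eta : lform M :=
  fun gamma vs => Complex a 0 * omega gamma vs + eta gamma vs.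

Definition form_zero : lform M := fun _ _ => 0.

(** The smoothness clause of [is_form] by itself, so that it can be stated for contractions. *)
Definition smooth_on_families omega :=
  forall m (c : 'rV[R]_m -> loop M) (js : seq 'I_m) u, smooth_family c ->
    csmooth_at (fun w => omega (c w) [seq dfamily c w j | j <- js]) u.

Lemma form_parity_lin b a omega eta :
  form_parity b omega -> form_parity b eta -> form_parity b (form_lin a omega
    eta).
Proof.
by move=> po pe gamma vs tvs bvs; rewrite /form_lin po// pe// mulr0 addr0.
Qed.

Lemma is_form_lin a omega eta :
  is_form omega -> is_form eta -> is_form (form_lin a omega eta).
Proof.
move=> [mo ao so] [me ae se]; split.
- move=> gamma us v w vs b tan; rewrite /form_lin mo// me//.
  by rewrite !mulrDr !mulrA (mulrC (Complex a 0) (Complex b 0)) addrACA.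
- move=> gamma vs i j tvs ij vij.
  by rewrite /form_lin (ao _ _ i j)// (ae _ _ i j)// mulr0 addr0.
- move=> m c js u sc; apply: csmooth_at_lin; [exact: so|exact: se].
Qed.

(** Smoothness along families makes the derivatives in the formula for the exterior derivative
    exist, hence additive. *)
Lemma is_extd_lin a omega eta d_omega d_eta :
  smooth_on_families omega -> smooth_on_families eta ->
  is_extd omega d_omega -> is_extd eta d_eta ->
  is_extd (form_lin a omega eta) (form_lin a d_omega d_eta).
Proof.
move=> so se ho he m c u sc; rewrite /form_lin ho// he// mulr_sumr -big_split
  /=.
apply: eq_bigr => i _; rewrite cderive_lin; [|exact: so|exact: se].
by rewrite mulrDr mulrCA.
Qed.

Lemma is_form_zero : is_form form_zero.
Proof.
split=> // [gamma us v w vs a _|m c js u _];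
  first by rewrite /form_zero mulr0 addr0.
by split; exact: smooth_at_cst.
Qed.

Lemma is_extd_zero : is_extd form_zero form_zero.
Proof.
move=> m c u _; rewrite [RHS]big1// => i _.
by rewrite /form_zero cderive_cst mulr0.
Qed.

Lemma Omega_S1_zero b : Omega_S1 b form_zero.
Proof.
split=> //; first exact: is_form_zero.
exists form_zero, form_zero; split; try exact: is_form_zero;
  try exact: is_extd_zero.
by move=> gamma vs _; rewrite /form_add /contraction /form_zero addr0.
Qed.

Lemma d_iota_exact_zero : d_iota_exact form_zero.
Proof.
exists form_zero, form_zero; split;
  [exact: Omega_S1_zero|exact: is_form_zero|exact: is_extd_zero|].
by move=> gamma vs _; rewrite /form_add /contraction /form_zero addr0.
Qed.

End LinearCombinationsOfForms.

(** * Rotation of loops and linearity of d + iota *)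

Section Rotation.
Context {R : realType} {n : nat} {M : manifold R n}.

(** Periodicity and smoothness are propositions, so proof irrelevance applies. A true equality of
    loops is required because forms are arbitrary functions of loops. *)
Lemma loop_ext (gamma delta : loop M) : gamma =1 delta -> gamma = delta.
Proof.
case: gamma delta => [f pf sf] [g pg sg] /= /funext fg; case: _ / fg in pg sg *.
by congr Loop; exact: Prop_irrelevance.
Qed.

(** A directional derivative sees only one line, so families with different numbers of parameters
    can be compared. *)
Lemma eq_derive_along (V V' W : normedModType R) (f : V -> W) (g : V' -> W) x
  v y w :
  (forall h : R, f (h *: v + x) = g (h *: w + y)) -> 'D_v f x = 'D_w g y.
Proof.
move=> fg; have fg0 : f x = g y by have := fg 0; rewrite !scale0r !add0r.
rewrite /derive (_ : (fun h : R => _) =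
  (fun h => h^-1 *: ((g \o shift y) (h *: w) - g y)))//.
by apply/funext => h /=; rewrite fg fg0.
Qed.

Lemma msmooth_at_comp_affine (V V' : normedModType R) (L : V -> V')
    (L0 : V -> V') (c : V' -> M) (x : V) :
  continuous L -> (forall h v y, L (h *: v + y) = h *: L0 v + L y) ->
  msmooth_at c (L x) -> msmooth_at (c \o L) x.
Proof.
move=> cL aff [cc sc]; split; first by apply: continuous_comp => //; exact: cL.
exact: (smooth_at_comp_affine (f := fwd (c (L x)) \o c)) aff _.
Qed.

Lemma continuous_row_mx0 m : continuous (fun w : 'rV[R]_m =>
  row_mx w (0 : 'rV[R]_1)).
Proof.
move=> w A /nbhs_ballP[e /= e0 eA]; apply/nbhs_ballP;
  exists e => //= w' [_ ww'].
apply: eA; split => // i j; case: (splitP j) => k jk.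
  by rewrite (_ : j = lshift 1 k) ?row_mxEl//; exact: val_inj.
rewrite (_ : j = rshift m k); last exact: val_inj.
by rewrite !row_mxEr; exact: ballxx.
Qed.

Lemma continuous_lsubmx m : continuous (lsubmx : 'rV[R]_(m + 1) -> 'rV[R]_m).
Proof.
move=> w A /nbhs_ballP[e /= e0 eA]; apply/nbhs_ballP;
  exists e => //= w' [_ ww'].
by apply: eA; split => // i j; rewrite !mxE; exact: ww'.
Qed.

Section Rotate.
Variables (tau : R) (gamma : loop M).

Let rotate_periodic t : gamma (t + 1 + tau) = gamma (t + tau).
Proof. by rewrite addrAC loop_periodic. Qed.

Let rotate_smooth t : msmooth_at ((fun t => gamma (t + tau)) : R^o -> M) t.
Proof.
apply: (msmooth_at_comp_affine (L := fun t : R^o => t + tau : R^o)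
  (L0 := idfun) (c := gamma : R^o -> M)).
- by move=> x; apply: cvgD => //; exact: cvg_cst.
- by move=> h v y; rewrite addrA.
- exact: loop_smooth.
Qed.

Definition rotate : loop M := Loop rotate_periodic rotate_smooth.

End Rotate.

Section RotatedFamily.
Variables (m : nat) (c : 'rV[R]_m -> loop M).
Hypothesis sc : smooth_family c.

(** The last coordinate of the parameter is the angle of rotation. *)
Definition rotated_family (w : 'rV[R]_(m + 1)) : loop M :=
  rotate (w 0 (rshift m ord0)) (c (lsubmx w)).

(** The evaluation of the rotated family is that of [c] after the linear map [L], which adds the
    angle to the time. *)
Lemma smooth_rotated_family : smooth_family rotated_family.
Proof.
move=> u t.
pose L (wt : 'rV[R]_(m + 1) * R^o) : 'rV[R]_m * R^o :=
  (lsubmx wt.1, wt.2 + wt.1 0 (rshift m ord0)).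
apply: (msmooth_at_comp_affine (L := L) (L0 := L)
  (c := fun ut : 'rV[R]_m * R^o => c ut.1 ut.2)).
- apply: continuous_pair => wt.
    exact: (@continuous_comp _ _ _ fst lsubmx wt cvg_fst (@continuous_lsubmx m
      _)).
  have c1 : {for wt, continuous (fun z : 'rV[R]_(m + 1) * R^o =>
      (z.1 0 (rshift m ord0) : R^o))}.
    exact: (@continuous_comp _ _ _ fst (fun w : 'rV[R]_(m + 1) =>
      w 0 (rshift m ord0) : R^o) wt cvg_fst (@coord_continuous _ _ _ _ _ _)).
  exact: (@cvgD _ R^o _ _ _ snd _ _ _ cvg_snd c1).
- move=> h [v s] [w s']; rewrite /L /=; congr pair; first by rewrite linearP.
  by rewrite /= !mxE /GRing.scale /= mulrDr addrACA.
- exact: sc.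
Qed.

Lemma rotated_family0 w : rotated_family (row_mx w 0) = c w.
Proof.
by apply: loop_ext => t /=; rewrite row_mxKl row_mxEr mxE addr0.
Qed.

Lemma dfamily_rotated w j :
  dfamily rotated_family (row_mx w 0) (lshift 1 j) = dfamily c w j.
Proof.
apply/funext => t; apply: eq_derive_along => h.
by rewrite delta_mx_lshift scale_row_mx add_row_mx scaler0 addr0
  !rotated_family0.
Qed.

(** Changing the angle from 0 to [h] turns the value at time [t] into the value at time [t + h]. *)
Lemma dfamily_rotation w :
  dfamily rotated_family (row_mx w 0) (rshift m ord0) = velocity (c w).
Proof.
apply/funext => t; apply: eq_derive_along => h.
rewrite delta_mx_rshift scale_row_mx add_row_mx scaler0 add0r addr0.
rewrite rotated_family0 /= row_mxKl row_mxEr !mxE !eqxx.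
by rewrite [t + _]addrC.
Qed.

End RotatedFamily.

(* The velocity field generates the rotations of the loop, so contracting with
   it amounts to evaluating on one more direction of a larger family. *)
Lemma contraction_smooth (omega : lform M) :
  smooth_on_families omega -> smooth_on_families (contraction omega).
Proof.
move=> so m c js u sc.
have := so _ (rotated_family c) (rshift m ord0 :: [seq lshift 1 j | j <- js])
  (row_mx u 0) (smooth_rotated_family sc).
(* Composition with this linear inclusion restricts to angle 0, where the added direction is the
   velocity and the others are those of [c]. *)
move=> /(csmooth_at_comp_affine (L := fun w : 'rV[R]_m =>
  row_mx w (0 : 'rV[R]_1))
  (L0 := fun w => row_mx w 0)).
move=> /(_ (@continuous_row_mx0 m)).
rewrite (_ : _ \o _ =
  (fun w => contraction omega (c w) [seq dfamily c w j | j <- js])); last first.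
  apply/funext => w; rewrite /contraction /= rotated_family0 dfamily_rotation.
  by rewrite -map_comp; congr (omega _ (_ :: _)); apply: eq_map => j /=;
    rewrite dfamily_rotated.
by apply => h v y; rewrite scale_row_mx add_row_mx scaler0 addr0.
Qed.

Lemma Omega_S1_lin b a (omega eta : lform M) :
  Omega_S1 b omega -> Omega_S1 b eta -> Omega_S1 b (form_lin a omega eta).
Proof.
move=> [fo po [d1 [e1 [fd1 hd1 fe1 he1 k1]]]] [fe pe [d2 [e2 [fd2 hd2 fe2 he2
  k2]]]].
split; [exact: is_form_lin|exact: form_parity_lin|].
exists (form_lin a d1 d2), (form_lin a e1 e2); split.
- exact: is_form_lin.
- apply: is_extd_lin hd1 hd2; exact: form_smooth.
- exact: is_form_lin.
- apply: is_extd_lin he1 he2; apply: contraction_smooth; exact: form_smooth.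
- move=> gamma vs tvs; have := k1 _ _ tvs; have := k2 _ _ tvs.
  rewrite /form_add /contraction /form_lin => k2' k1'.
  by rewrite addrACA -mulrDr k1' k2' mulr0 addr0.
Qed.

Lemma d_iota_exact_lin a (omega eta : lform M) :
  d_iota_exact omega -> d_iota_exact eta -> d_iota_exact (form_lin a omega eta).
Proof.
move=> [H1 [d1 [h1 f1 e1 q1]]] [H2 [d2 [h2 f2 e2 q2]]].
exists (form_lin a H1 H2), (form_lin a d1 d2); split.
- exact: Omega_S1_lin.
- exact: is_form_lin.
- by case: h1 => [[_ _ s1] _ _]; case: h2 => [[_ _ s2] _ _]; exact: is_extd_lin.
- move=> gamma vs tvs; rewrite /form_lin q1// q2//.
  by rewrite /form_add /contraction mulrDr addrACA.
Qed.

End Rotation.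

(** * Piecewise smooth paths of connections *)

Section PiecewiseSmoothPaths.
Context {R : realType} {n : nat} {M : manifold R n} {E : vbundle M}.
Implicit Types D : R -> connection E.

Lemma smooth_path_affine D c d :
  smooth_path D -> smooth_path (fun s => D (c * s + d)).
Proof.
move=> sD s x X sigma sX ssigma k.
have := sD (c * s + d) x X sigma sX ssigma k.
pose L (sz : R^o * 'rV[R]_n) : R^o * 'rV[R]_n := (c *: sz.1 + d, sz.2).
apply: (csmooth_at_comp_affine (L := L) (L0 := fun sz => (c *: sz.1, sz.2))
  (x := (s, fwd x x))).
- apply: continuous_pair => sz; last exact: cvg_snd.
  exact: (@cvgD _ R^o _ _ _ _ _ _ _ (@cvgZl_tmp _ R^o _ _ _ c fst _ cvg_fst)
    (cvg_cst _)).
- move=> h [s1 z1] [s2 z2]; rewrite /L /=; congr pair.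
  by rewrite /GRing.scale /= mulrDr mulrCA addrA.
Qed.

Lemma smooth_path_cst (D0 : connection E) : smooth_path (fun=> D0).
Proof.
move=> s x X sigma sX ssigma k; have := nabla_smooth D0 sX ssigma.
move=> /(_ k 0); rewrite /mcsmooth_at.
apply: (csmooth_at_comp_affine (L := snd : R^o * 'rV[R]_n -> 'rV[R]_n)
  (L0 := snd) (x := (s, fwd x x))) => //.
by move=> sz; exact: cvg_snd.
Qed.

Definition smooth_piece D (a b : R) := exists D' : R -> connection E,
  smooth_path D' /\ forall s, a <= s <= b -> D s = D' s.

(** The list of break points in [piecewise_smooth_path], in inductive form and with arbitrary end
    points, so that cutting, gluing and reversal go by induction on the pieces. *)
Inductive piecewise_smooth_on D : R -> R -> Prop :=
| piecewise_smooth_nil a : piecewise_smooth_on D a a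
| piecewise_smooth_cons a b e : a < b -> smooth_piece D a b ->
    piecewise_smooth_on D b e -> piecewise_smooth_on D a e.

Lemma piecewise_smooth_pathP D :
  piecewise_smooth_path D <-> piecewise_smooth_on D 0 1.
Proof.
have onP a b : piecewise_smooth_on D a b <-> exists ss : seq R,
    [/\ path <%R a ss, last a ss = b & forall i, (i < size ss)%N ->
        smooth_piece D (nth 0 (a :: ss) i) (nth 0 ss i)].
  split.
    elim=> {a b} [a|a b e ab sD _ [ss [pss lss sss]]]; first by exists [::].
    exists (b :: ss); split => //=; first by rewrite ab.
    by case=> [//|i]; exact: sss.
  move=> [ss []]; elim: ss a => [|s ss IH] a /=.
    by move=> _ <- _; exact: piecewise_smooth_nil.
  move=> /andP[as_ pss] lss sss;
    apply: (piecewise_smooth_cons as_ (sss 0%N isT)).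
  by apply: IH => // i; exact: (sss i.+1).
by rewrite onP.
Qed.

Lemma piecewise_smooth_on_le D a b : piecewise_smooth_on D a b -> a <= b.
Proof. by elim=> // {a b} a b e /ltW ab _ _; exact: le_trans. Qed.

Lemma piecewise_smooth_cat D a b e : piecewise_smooth_on D a b ->
  piecewise_smooth_on D b e -> piecewise_smooth_on D a e.
Proof.
by elim=> // {a b} a b b' ab sD _ IH /IH; exact: piecewise_smooth_cons.
Qed.

Lemma eq_piecewise_smooth D D' a b : (forall s, a <= s <= b -> D s = D' s) ->
  piecewise_smooth_on D a b -> piecewise_smooth_on D' a b.
Proof.
move=> DD' sD; elim: sD DD' => {a b} [a _|a b e ab [D2 [sD2 DD2]] sD IH DD'].
  exact: piecewise_smooth_nil.
have be := piecewise_smooth_on_le sD.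
apply: (piecewise_smooth_cons ab).
  exists D2; split => // s /andP[as_ sb]; rewrite -DD2 ?as_//.
  by rewrite DD'// as_ (le_trans sb).
by apply: IH => s /andP[bs se]; apply: DD';
  rewrite se andbT (le_trans (ltW ab)).
Qed.

Lemma piecewise_smooth_affine D c d a b : 0 < c ->
  piecewise_smooth_on D (c * a + d) (c * b + d) ->
  piecewise_smooth_on (fun s => D (c * s + d)) a b.
Proof.
move=> c0; have cd s : s = c * ((s - d) / c) + d by field; rewrite gt_eqF.
have dc s : s = (c * s + d - d) / c by field; rewrite gt_eqF.
(* Induction on the pieces of [D] requires its end points to be variables, so those of the new path
   are written as their preimages. *)
suff sub a' b' : piecewise_smooth_on D a' b' ->
    piecewise_smooth_on (fun s => D (c * s + d)) ((a' - d) / c) ((b' - d) / c).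
  by move=> /sub; rewrite -!dc.
elim=> {a b a' b'} [a|a b e ab [D2 [sD2 DD2]] sD IH];
  first exact: piecewise_smooth_nil.
apply: piecewise_smooth_cons IH; first by rewrite ltr_pM2r ?invr_gt0// ltrD2r.
exists (fun s => D2 (c * s + d)); split; first exact: smooth_path_affine.
move=> s; rewrite ler_pdivrMr// ler_pdivlMr// lerBlDr lerBrDr mulrC => /DD2.
by [].
Qed.

Lemma piecewise_smooth_rev D a b : piecewise_smooth_on D a b ->
  piecewise_smooth_on (fun s => D (-1 * s + 1)) (1 - b) (1 - a).
Proof.
elim=> {a b} [a|a b e ab [D2 [sD2 DD2]] sD IH];
  first exact: piecewise_smooth_nil.
(* The first piece of [D] becomes the last one of the reversed path, on [1 - b <= s <= 1 - a]. *)
apply: piecewise_smooth_cat IH _.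
apply: piecewise_smooth_cons (piecewise_smooth_nil _ _); first by lra.
exists (fun s => D2 (-1 * s + 1)); split; first exact: smooth_path_affine.
by move=> s sab; apply: DD2; move: sab => /andP[? ?]; apply/andP; split; lra.
Qed.

End PiecewiseSmoothPaths.

(** * BCS forms of constant, reversed and concatenated paths *)

Section BCSDensity.
Context {R : realType} {n : nat} {M : manifold R n} {E : vbundle M}.
Implicit Types (D : R -> connection E) (a b c d : R).
Local Notation mu := (@lebesgue_measure R).

Definition mx_int_on r a b (F : R -> 'M[R[i]]_r) : 'M[R[i]]_r :=
  \matrix_(i, j) cint a b (fun s => F s i j).

Definition mx_integrable_on r a b (F : R -> 'M[R[i]]_r) := forall i j,
  mu.-integrable `[a, b] (EFin \o (fun s => complex.Re (F s i j))) /\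
  mu.-integrable `[a, b] (EFin \o (fun s => complex.Im (F s i j))).

(** The factor [c] of the integrand meets the factor 1/|c| of the substitution; what remains is the
    sign of [c]. *)
Lemma mx_int_on_affine r a b a' b' c d (F : R -> 'M[R[i]]_r) : c != 0 ->
  (forall s, (a' <= s <= b') = (a <= c * s + d <= b)) ->
  mx_integrable_on a b F ->
  let F' := fun s => Complex c 0 *: F (c * s + d) in
  mx_integrable_on a' b' F' /\
  mx_int_on a' b' F' = Complex (Num.sg c) 0 *: mx_int_on a b F.
Proof.
move=> c0 ab iF F'.
have abE : `[a', b']%classic = (fun s => c * s + d) @^-1` `[a, b]%classic.
  by apply/seteqP; split => s /=; rewrite !in_itv /= ab.
split=> [i j|].
  have [re im] := iF i j.
  have reL := integrable_affine d c0 (f := fun s =>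
    complex.Re (F s i j)) (measurable_itv _) re.
  have imL := integrable_affine d c0 (f := fun s =>
    complex.Im (F s i j)) (measurable_itv _) im.
  rewrite -abE in reL imL; split.
    rewrite (_ : _ \o _ = (fun s => c%:E * (EFin \o (fun s =>
      complex.Re (F (c * s + d) i j))%R) s)%E).
      by apply: (integrableZl _ c reL); exact: measurable_itv.
    by apply/funext => s /=; rewrite mxE Re_realM.
  rewrite (_ : _ \o _ = (fun s => c%:E * (EFin \o (fun s =>
    complex.Im (F (c * s + d) i j))%R) s)%E).
    by apply: (integrableZl _ c imL); exact: measurable_itv.
  by apply/funext => s /=; rewrite mxE Im_realM.
apply/matrixP => i j; have [re im] := iF i j.
rewrite !mxE (_ : (fun s => F' s i j) = (fun s =>
  Complex c 0 * F (c * s + d) i j)); last first.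
  by apply/funext => s; rewrite mxE.
rewrite cintZ /cint abE (Rintegral_affine d c0 _ re)// (Rintegral_affine d c0
  _ im)//.
by rewrite !realM_Complex !mulrA -numEsg.
Qed.

(** The point [b], where [h] follows [f], is null, so it can be removed from the second interval to
    make the two disjoint. *)
Lemma Rintegral_cat a b e (f g : R -> R) : a <= b -> b <= e ->
  mu.-integrable `[a, b] (EFin \o f) -> mu.-integrable `[b, e] (EFin \o g) ->
  let h := fun s => if s <= b then f s else g s in
  mu.-integrable `[a, e] (EFin \o h) /\
  \int[mu]_(s in `[a, e]) h s =
  \int[mu]_(s in `[a, b]) f s + \int[mu]_(s in `[b, e]) g s.
Proof.
move=> ab be fi gi h.
have gi' : mu.-integrable `]b, e] (EFin \o g).
  apply: integrableS gi => // s /=; rewrite !in_itv /= => /andP[/ltW -> ->//].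
have hf : {in `[a, b]%classic, f =1 h}.
  by move=> s; rewrite inE /= in_itv /= /h => /andP[_ ->].
have hg : {in `]b, e]%classic, g =1 h}.
  by move=> s; rewrite inE /= in_itv /= /h => /andP[bs _]; rewrite leNgt bs.
have hi1 : mu.-integrable `[a, b] (EFin \o h).
  by apply: eq_integrable fi => // s sab; rewrite /= hf.
have hi2 : mu.-integrable `]b, e] (EFin \o h).
  by apply: eq_integrable gi' => // s sab; rewrite /= hg.
have aeE : `[a, e]%classic = `[a, b]%classic `|` `]b, e]%classic.
  apply/seteqP; split => s /=; rewrite !in_itv /=.
    by move=> /andP[as_ se]; case: (lerP s b) => sb; [left|right];
      rewrite ?as_ ?sb.
  move=> [] /andP[].
    by move=> -> sb; exact: le_trans be.
  by move=> bs ->; rewrite andbT (le_trans ab)// ltW.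
have dis : [disjoint `[a, b]%classic & `]b, e]%classic].
  apply/disj_setPS => s [] /=; rewrite !in_itv /= => /andP[_ sb] /andP[bs _].
  by have := lt_le_trans bs sb; rewrite ltxx.
have hi : mu.-integrable `[a, e] (EFin \o h).
  have /integrableP[m1 i1] := hi1; have /integrableP[m2 i2] := hi2.
  have m12 : measurable_fun (`[a, b] `|` `]b, e]) (EFin \o h).
    by apply/measurable_funU.
  rewrite aeE; apply/integrableP; split => //.
  rewrite ge0_integral_setU//; first by rewrite lte_add_pinfty.
  exact: measurableT_comp.
split=> //; rewrite {1}aeE Rintegral_setU//; last by rewrite -aeE.
congr +%R; first by apply: eq_Rintegral => s /hf.
by rewrite -(Rintegral_itv_obnd_cbnd gi'); apply: eq_Rintegral => s /hg.
Qed.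

Lemma mx_int_on_cat r a b e (F G : R -> 'M[R[i]]_r) : a <= b -> b <= e ->
  mx_integrable_on a b F -> mx_integrable_on b e G ->
  let H := fun s => if s <= b then F s else G s in
  mx_integrable_on a e H /\
  mx_int_on a e H = mx_int_on a b F + mx_int_on b e G.
Proof.
move=> ab be iF iG H.
have re i j := Rintegral_cat ab be (iF i j).1 (iG i j).1.
have im i j := Rintegral_cat ab be (iF i j).2 (iG i j).2.
have ReE i j : (fun s => complex.Re (H s i j)) =
    (fun s => if s <= b then complex.Re (F s i j) else complex.Re (G s i j)).
  by apply/funext => s; rewrite /H; case: ifP.
have ImE i j : (fun s => complex.Im (H s i j)) =
    (fun s => if s <= b then complex.Im (F s i j) else complex.Im (G s i j)).
  by apply/funext => s; rewrite /H; case: ifP.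
split=> [i j|]; first by rewrite ReE ImE; split;
  [exact: (re i j).1|exact: (im i j).1].
apply/matrixP => i j; rewrite !mxE /cint ReE ImE.
by rewrite (re i j).2 (im i j).2.
Qed.

Lemma ae_neq x : {ae mu, forall s, s != x}.
Proof.
exists [set x]; split=> //; first exact: lebesgue_measure_set1.
by move=> s /= /negP; rewrite negbK => /eqP.
Qed.

Section FixedLoop.
Variables (gamma : loop M) (r p : nat) (phi : 'I_p -> loctriv E r).
Variables (k : nat) (vs : seq (lvec R n)).

(** The conditions on the witness in [is_BCS], on an arbitrary interval, so that the pieces of a
    path can be treated separately. *)
Definition bcs_density D a b (F : R -> 'M[R[i]]_r) : Prop :=
  {ae mu, forall s, a <= s <= b ->
    mx_cvg (fun N => bcs_partial_sum D s phi gamma k N vs) (F s)} /\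
  mx_integrable_on a b F.

(** The s-derivative depends only on the path near [s], and a glued path is a reparametrization of
    one of its pieces only locally. *)
Lemma conn_mx_ds_affine D D' c d s i x v :
  (\forall s' \near (s : R^o), D' s' = D (c * s' + d)) ->
  conn_mx_ds (phi i) D' s x v =
  Complex c 0 *: conn_mx_ds (phi i) D (c * s + d) x v.
Proof.
move=> DD'; have affE h : c * (h *: (1 : R^o) + s) + d =
    (c * h) *: (1 : R^o) + (c * s + d) by rewrite /GRing.scale /= !mulr1
      mulrDr addrA.
apply/matrixP => a b; rewrite !mxE /cderive.
have part (pr : R[i] -> R) :
    'D_(1 : R^o) (fun s' : R^o => pr (conn_mx (phi i) (D' s') x v a b) : R^o)
      (s : R^o) =
    c * 'D_(1 : R^o) (fun s' : R^o => pr (conn_mx (phi i) (D s') x v a b) : R^o)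
      (c * s + d : R^o).
  rewrite (near_eq_derive (g := fun s' : R^o =>
    pr (conn_mx (phi i) (D (c * s' + d)) x v a b) : R^o)).
    by apply: derive_scale => h; rewrite affE.
  apply: filterS DD' => s' e.
  exact: (congr1 (fun Z => pr (conn_mx (phi i) Z x v a b)) e).
rewrite (part (@complex.Re R)) (part (@complex.Im R)).
by rewrite realM_Complex.
Qed.

(** The paths are compared on the open interval, since at an end point the derivative of [D'] also
    sees the adjacent piece. The two end points form a null set. *)
Lemma bcs_density_affine D D' a b a' b' c d F : c != 0 ->
  (forall s, (a' <= s <= b') = (a <= c * s + d <= b)) ->
  (forall s, a' < s < b' -> D' s = D (c * s + d)) ->
  bcs_density D a b F ->
  let F' := fun s => Complex c 0 *: F (c * s + d) in
  bcs_density D' a' b' F' /\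
  mx_int_on a' b' F' = Complex (Num.sg c) 0 *: mx_int_on a b F.
Proof.
move=> c0 ab DD' [aeF iF] F'; have [iF' eF'] := mx_int_on_affine c0 ab iF.
split=> //; split=> //.
have := ae_affine d c0 aeF.
apply: filterS3 (ae_neq a') (ae_neq b') => s sa sb + /andP[as_ bs].
rewrite -ab as_ bs => /(_ isT) cvgs.
have sab : a' < s < b' by rewrite !lt_neqAle as_ bs eq_sym sa sb.
rewrite (_ : (fun N => _) = (fun N => Complex c 0 *:
  bcs_partial_sum D (c * s + d) phi gamma k N vs)); first exact: mx_cvgZ.
apply/funext => N; apply: bcs_partial_sumZ; first exact: DD'.
move=> i x v; apply: conn_mx_ds_affine.
near=> s'; apply: DD'.
have : s' \in `]a', b'[ by near: s'; apply: near_in_itvoo; rewrite in_itv.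
by rewrite in_itv.
Unshelve. all: by end_near. Qed.

Lemma bcs_density_cat D a b e F G : a <= b -> b <= e ->
  bcs_density D a b F -> bcs_density D b e G ->
  let H := fun s => if s <= b then F s else G s in
  bcs_density D a e H /\
  mx_int_on a e H = mx_int_on a b F + mx_int_on b e G.
Proof.
move=> ab be [aeF iF] [aeG iG] H; have [iH eH] := mx_int_on_cat ab be iF iG.
split=> //; split=> //.
have FF : Filter (almost_everywhere mu) := ae_filter_ringOfSetsType _.
apply: (@filterS2 _ _ FF _ _ _ _ aeF aeG) => s cF cG /andP[as_ se]; rewrite /H.
by case: ifPn => [sb|]; [apply: cF; rewrite as_|rewrite -ltNge => /ltW bs;
  apply: cG; rewrite bs].
Qed.

End FixedLoop.

Lemma is_BCS_density D (omega : lform M) :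
  is_BCS D omega <-> form_parity true omega /\
  forall gamma r p (phi : 'I_p -> loctriv E r) k vs,
    (0 < p)%N -> (forall i, smooth_triv (phi i)) -> in_nbhd phi gamma ->
    size vs = k.*2.+1 -> all_tangent gamma vs ->
    exists2 F, bcs_density gamma phi k vs D 0 1 F &
      omega gamma vs = \tr (mx_int_on 0 1 F).
Proof.
split=> -[po H]; split=> // gamma r p phi k vs p0 sphi nphi kvs tvs.
  have [F [aeF iF oF]] := H _ _ _ _ _ _ p0 sphi nphi kvs tvs.
  by exists F => //; split=> //; apply: filterS aeF => s + s01; apply;
    rewrite in_itv.
have [F [aeF iF] oF] := H _ _ _ _ _ _ p0 sphi nphi kvs tvs.
by exists F; split=> //; apply: filterS aeF => s + s01; apply; move: s01;
  rewrite in_itv.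
Qed.

Lemma is_BCS_cst (D0 : connection E) : is_BCS (fun=> D0) (form_zero : lform M).
Proof.
apply/is_BCS_density; split=> // gamma r p phi k vs _ _ _ _ _.
have partial0 s N : bcs_partial_sum (fun=> D0) s phi gamma k N vs = 0.
  (* The constant path is compared with itself with the scalar 0, which is legitimate because its
     s-derivative is 0. *)
  rewrite (@bcs_partial_sumZ _ _ _ _ (fun=> D0) (fun=> D0) s s 0)//.
    exact: scale0r.
  by move=> i x v; apply/matrixP => a b; rewrite !mxE cderive_cst mulr0.
exists (fun=> 0); first split.
- apply: aeW => s _ a b.
  rewrite (_ : (fun N => complex.Re _) = cst (complex.Re ((0 : 'M[R[i]]_r) a
    b)));
    last by apply/funext => N; rewrite partial0.
  rewrite (_ : (fun N => complex.Im _) = cst (complex.Im ((0 : 'M[R[i]]_r) a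
    b)));
    last by apply/funext => N; rewrite partial0.
  by split; exact: cvg_cst.
- by move=> i j; rewrite /= mxE; split; exact: integrable0.
- rewrite (_ : mx_int_on 0 1 _ = 0) ?mxtrace0//; apply/matrixP => i j.
  by rewrite !mxE /cint /Rintegral /= !integral0.
Qed.

Lemma is_BCS_rev D (omega : lform M) : is_BCS D omega ->
  is_BCS (fun s => D (-1 * s + 1)) (form_lin (-1) omega form_zero).
Proof.
move=> /is_BCS_density[po H]; apply/is_BCS_density; split.
  exact: form_parity_lin.
move=> gamma r p phi k vs p0 sphi nphi kvs tvs.
have [F dF oF] := H _ _ _ _ _ _ p0 sphi nphi kvs tvs.
have [|||dF' eF'] := bcs_density_affine (c := -1) (d := 1) (a' := 0) (b' := 1)
  (D' := fun s => D (-1 * s + 1)) _ _ _ dF.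
- by rewrite oppr_eq0 oner_eq0.
- by move=> s; apply/idP/idP => /andP[? ?]; apply/andP; split; lra.
- by [].
exists (fun s => Complex (-1) 0 *: F (-1 * s + 1)) => //.
by rewrite eF' sgrN sgr1 mxtraceZ -oF /form_lin /form_zero addr0.
Qed.

(** The arguments have the form [c * s + d] of the reparametrization lemmas. At 1/2 the first path
    decides. *)
Definition path_cat D D' : R -> connection E :=
  fun s => if s <= 2^-1 then D (2 * s + 0) else D' (2 * s + -1).

Lemma is_BCS_cat D D' (omega eta : lform M) :
  is_BCS D omega -> is_BCS D' eta ->
  is_BCS (path_cat D D') (form_lin 1 omega eta).
Proof.
move=> /is_BCS_density[po H] /is_BCS_density[pe H']; apply/is_BCS_density;
  split.
  exact: form_parity_lin.
move=> gamma r p phi k vs p0 sphi nphi kvs tvs.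
have [F dF oF] := H _ _ _ _ _ _ p0 sphi nphi kvs tvs.
have [G dG oG] := H' _ _ _ _ _ _ p0 sphi nphi kvs tvs.
have two0 : (2 : R) != 0 by rewrite pnatr_eq0.
have [||dF' eF'] := bcs_density_affine (c := 2) (d := 0) (a' := 0) (b' := 2^-1)
  (D' := path_cat D D') two0 _ _ dF.
- by move=> s; apply/idP/idP => /andP[? ?]; apply/andP; split; lra.
- by move=> s /andP[_ /ltW]; rewrite /path_cat => ->.
have [||dG' eG'] := bcs_density_affine (c := 2) (d := -1) (a' := 2^-1) (b' := 1)
  (D' := path_cat D D') two0 _ _ dG.
- by move=> s; apply/idP/idP => /andP[? ?]; apply/andP; split; lra.
- by move=> s /andP[hs _]; rewrite /path_cat leNgt hs.
have half0 : 0 <= 2^-1 :> R by rewrite invr_ge0 ler0n.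
have half1 : 2^-1 <= 1 :> R by rewrite invf_le1 ?ler1n ?ltr0n.
have [dH eH] := bcs_density_cat half0 half1 dF' dG'.
eexists; first exact: dH.
(* Both slopes are 2, of sign 1, so each half contributes the full integral of its path. *)
rewrite eH mxtraceD eF' eG' !mxtraceZ -oF -oG gtr0_sg ?ltr0n//.
by rewrite /form_lin -[Complex 1 0]/(1 : R[i]) !mul1r.
Qed.

End BCSDensity.

(** * Reflexivity, symmetry and transitivity *)

Theorem mainTheorem3 (R : realType) (n : nat) (M : manifold R n)
    (E : vbundle M) :
  Equivalence (@BCS_equivalent R n M E).
Proof.
split.
- move=> D0; exists (fun=> D0), form_zero; split=> //.
  + apply/piecewise_smooth_pathP.
    apply: (piecewise_smooth_cons ltr01 _ (piecewise_smooth_nil _ _)).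
    by exists (fun=> D0); split=> //; exact: smooth_path_cst.
  + exact: Omega_S1_zero.
  + exact: is_BCS_cst.
  + exact: d_iota_exact_zero.
- move=> D0 D1 [D [omega [sD [DE0 DE1] oo bo eo]]].
  exists (fun s => D (-1 * s + 1)), (form_lin (-1) omega form_zero); split.
  + apply/piecewise_smooth_pathP; move/piecewise_smooth_pathP: sD.
    by move/piecewise_smooth_rev; rewrite subrr subr0.
  + by rewrite mulr0 add0r mulr1 addNr.
  + by apply: Omega_S1_lin => //; exact: Omega_S1_zero.
  + exact: is_BCS_rev.
  + by apply: d_iota_exact_lin => //; exact: d_iota_exact_zero.
- move=> D0 D1 D2 [D [omega [sD [DE0 DE1] oo bo eo]]].
  move=> [D' [eta [sD' [DE0' DE1'] oe be ee]]].
  have two1 : 2 + -1 = 1 :> R by rewrite -[2]/(1 + 1) addrK.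
  exists (path_cat D D'), (form_lin 1 omega eta); split.
  + apply/piecewise_smooth_pathP.
    move/piecewise_smooth_pathP: sD => sD;
      move/piecewise_smooth_pathP: sD' => sD'.
    apply: (@piecewise_smooth_cat _ _ _ _ _ _ 2^-1).
      apply: (@eq_piecewise_smooth _ _ _ _ (fun s => D (2 * s + 0))).
        by move=> s /andP[_]; rewrite /path_cat => ->.
      by apply: piecewise_smooth_affine;
        rewrite ?ltr0n// mulr0 !addr0 mulfV ?pnatr_eq0.
    apply: (@eq_piecewise_smooth _ _ _ _ (fun s => D' (2 * s + -1))).
      move=> s /andP[hs _]; rewrite /path_cat; case: ifPn => // sh.
      (* The branches overlap only at 1/2, where they give [D 1] and [D' 0]; both equal the middle
         connection [D1]. *)
      have -> : s = 2^-1 by apply/eqP; rewrite eq_le hs sh.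
      by rewrite addr0 mulfV ?pnatr_eq0// subrr DE0' DE1.
    apply: piecewise_smooth_affine; rewrite ?ltr0n//.
    by rewrite mulfV ?pnatr_eq0// subrr mulr1 two1.
  + split; first by rewrite /path_cat invr_ge0 ler0n mulr0 addr0.
    rewrite /path_cat ifF; last by apply/negbTE;
      rewrite -ltNge invf_lt1 ?ltr1n ?ltr0n.
    by rewrite mulr1 two1.
  + exact: Omega_S1_lin.
  + exact: is_BCS_cat.
  + exact: d_iota_exact_lin.
Qed.
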